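(* Let $R\subseteq S$ be an almost-Prüfer extension. Then $R\subseteq S$ is quasi-Prüfer, $\widetilde R=\widehat R$, and $(\widetilde R)_P=\widetilde{R_P}$ for each $P\in\mathrm{Spec}(R)$. Moreover, every subextension $R\subseteq T$ (with $T\in[R,S]$) which is a flat epimorphism is Prüfer.
   Context: All rings are commutative with identity. $[R,S]$ is the set of $R$-subalgebras of $S$; $S_P$ is the localization at $R\setminus P$. A flat epimorphism is a flat ring morphism which is an epimorphism of commutative rings. $A\subseteq B$ is Prüfer if $A\subseteq U$ is a flat epimorphism for every $U\in[A,B]$; $A\subseteq B$ is quasi-Prüfer if the integral closure of $A$ in $B$ is Prüfer in $B$. $\widetilde R$ (Prüfer hull) is the greatest $U\in[R,S]$ with $R\subseteq U$ Prüfer; $\widehat R$ (Morita hull) is the greatest $U\in[R,S]$ with $R\subseteq U$ a flat epimorphism; $\widetilde{R_P}$ is the Prüfer hull of $R_P$ in $S_P$. $R\subseteq S$ is almost-Prüfer if there is $T\in[R,S]$ with $R\subseteq T$ Prüfer and $T\subseteq S$ integral. *)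

(* Defs.v *)
(* Subrings of an ambient commutative ring S are Prop-valued
   predicates on S; ring extensions A ⊆ B are pairs of such predicates. *)
From HB Require Import structures.
From mathcomp Require Import all_boot all_order all_algebra.
Set Implicit Arguments. Unset Strict Implicit. Unset Printing Implicit Defensive.
Import GRing.Theory.
Local Open Scope ring_scope.

Section Defs.
Variable S : comPzRingType.

Definition incl (A B : S -> Prop) := forall x, A x -> B x.

Definition subring (A : S -> Prop) :=
  [/\ A 1, (forall x y, A x -> A y -> A (x - y)) &
      (forall x y, A x -> A y -> A (x * y))].

Definition interm (A B U : S -> Prop) := [/\ subring U, incl A U & incl U B].

(* B is a flat A-module (equational criterion of flatness) *)
Definition flat (A B : S -> Prop) :=
  forall n (a x : 'I_n -> S),
    (forall i, A (a i)) -> (forall i, B (x i)) -> \sum_i a i * x i = 0 ->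
    exists m (c : 'I_n -> 'I_m -> S) (y : 'I_m -> S),
      [/\ (forall i j, A (c i j)), (forall j, B (y j)),
          (forall i, x i = \sum_j c i j * y j) &
          (forall j, \sum_i a i * c i j = 0)].

Definition rmorph_on (C : comPzRingType) (B : S -> Prop) (f : S -> C) :=
  [/\ f 1 = 1, (forall x y, B x -> B y -> f (x + y) = f x + f y) &
      (forall x y, B x -> B y -> f (x * y) = f x * f y)].

Definition epi (A B : S -> Prop) :=
  forall (C : comPzRingType) (f g : S -> C),
    rmorph_on B f -> rmorph_on B g -> (forall a, A a -> f a = g a) ->
    forall b, B b -> f b = g b.

Definition flat_epi (A B : S -> Prop) := flat A B /\ epi A B.

Definition prufer (A B : S -> Prop) :=
  forall U, interm A B U -> flat_epi A U.

Definition integral (A : S -> Prop) (x : S) :=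
  exists n (c : 'I_n -> S), (forall i, A (c i)) /\
    x ^+ n + \sum_(i < n) c i * x ^+ i = 0.

Definition int_closure (A B : S -> Prop) := fun x => B x /\ integral A x.

Definition quasi_prufer (A B : S -> Prop) := prufer (int_closure A B) B.

Definition almost_prufer (A B : S -> Prop) :=
  exists T, [/\ interm A B T, prufer A T & forall x, B x -> integral T x].

Definition greatest (P : (S -> Prop) -> Prop) (U : S -> Prop) :=
  P U /\ forall V, P V -> incl V U.

Definition prufer_hull (A B U : S -> Prop) :=
  greatest (fun V => interm A B V /\ prufer A V) U.

Definition morita_hull (A B U : S -> Prop) :=
  greatest (fun V => interm A B V /\ flat_epi A V) U.

Definition prime_ideal (A P : S -> Prop) :=
  [/\ incl P A, P 0, (forall x y, P x -> P y -> P (x + y)),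
      (forall r x, A r -> P x -> P (r * x)) &
      ~ P 1 /\ (forall x y, A x -> A y -> P (x * y) -> P x \/ P y)].
End Defs.

Definition is_localization (S L : comPzRingType) (M : S -> Prop)
    (phi : {rmorphism S -> L}) :=
  [/\ (forall m, M m -> exists v, v * phi m = 1),
      (forall l, exists s m v, [/\ M m, v * phi m = 1 & l = phi s * v]) &
      (forall s, phi s = 0 -> exists m, M m /\ m * s = 0)].

(* T_M viewed inside S_M = L *)
Definition loc_sub (S L : comPzRingType) (M : S -> Prop)
    (phi : {rmorphism S -> L}) (T : S -> Prop) : L -> Prop :=
  fun l => exists t m v, [/\ T t, M m, v * phi m = 1 & l = phi t * v].

(* Main.v *)
(* The key point is an elementwise description of both kinds of extensions.
   A subring inclusion A <= B is a flat epimorphism iff (A : b) B = B for every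
   b in B (Lazard); the direct implication compares b (x) 1 and 1 (x) b in a
   model of B (x)_A B. From this, R <= T is Prüfer iff 1 is in (R : t) + (R : t) t
   for every t in T: when R is integrally closed, every coefficient of a
   polynomial over R vanishing at t lies in (R : t) + (R : t) t.

   Let R <= T be Prüfer and T <= S integral. For s in S, invertibility of the
   R-module spanned by the coefficients of an integral equation of s over T,
   together with this content argument over the integral closure R' of R, gives
   1 in (R' : s) + (R' : s) s, so R' <= S is Prüfer. If R <= V is a flat
   epimorphism and v is in V, then (T : v) extends to the unit ideal in the
   integral T-algebra T V, so 1 is in (T : v) by Nakayama, and v is in T. Hence T
   is both hulls, and the same applies to the localizations of R <= T <= S. *)
Require Import Defs.
From HB Require Import structures.
From mathcomp Require Import all_boot all_order perm all_algebra.
From mathcomp Require Import boolp ring zify.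
Set Implicit Arguments. Unset Strict Implicit. Unset Printing Implicit Defensive.
Import GRing.Theory.
Local Open Scope ring_scope.

(** * Closure properties of subrings *)

Section Subring.
Variables (S : comPzRingType) (A : S -> Prop).
Hypothesis sA : subring A.

Lemma subring1 : A 1. Proof. by case: sA. Qed.

Lemma subringB x y : A x -> A y -> A (x - y). Proof. by case: sA => _ + _; apply. Qed.

Lemma subringM x y : A x -> A y -> A (x * y). Proof. by case: sA => _ _; apply. Qed.

Lemma subring0 : A 0.
Proof. by rewrite -(subrr 1); apply: subringB; apply: subring1. Qed.

Lemma subringN x : A x -> A (- x).
Proof. by move=> Ax; rewrite -sub0r; apply: subringB => //; apply: subring0. Qed.

Lemma subringD x y : A x -> A y -> A (x + y).
Proof. by move=> Ax Ay; rewrite -[y]opprK; apply/subringB/subringN. Qed.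

Lemma subringX x n : A x -> A (x ^+ n).
Proof.
move=> Ax; elim: n => [|n IHn]; first by rewrite expr0; apply: subring1.
by rewrite exprS; apply: subringM.
Qed.

Lemma subring_sum (I : Type) (r : seq I) (P : pred I) (F : I -> S) :
  (forall i, A (F i)) -> A (\sum_(i <- r | P i) F i).
Proof. by move=> AF; apply: big_ind => //; [apply: subring0 | apply: subringD]. Qed.

End Subring.

(** * Flat epimorphisms *)

(* (A : b) B = B *)
Definition locally_denom (S : comPzRingType) (A B : S -> Prop) (b : S) :=
  exists m (a z : 'I_m -> S),
    [/\ forall j, A (a j), forall j, A (a j * b), forall j, B (z j)
      & \sum_j a j * z j = 1].

(** * From denominators to flat epimorphisms *)

Section LocallyDenomFlatEpi.
Variables (S : comPzRingType) (A B : S -> Prop).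
Hypotheses (sA : subring A) (sB : subring B) (AB : incl A B).
Hypothesis denB : forall b, B b -> locally_denom A B b.

(** Since [a j] and [a j * b] lie in A, f and g agree on both, so f b = sum f(a_j b) f(z_j) = g b
    sum f(a_j) f(z_j) = g b. *)
Lemma locally_denom_epi : epi A B.
Proof.
move=> C f g [f1 fD fM] [g1 gD gM] fg b Bb.
have [m [a [z [Aa Aab Bz az1]]]] := denB Bb.
have f0 : f 0 = 0.
  have /eqP := fD 0 0 (subring0 sB) (subring0 sB).
  by rewrite addr0 -subr_eq0 opprD addNKr oppr_eq0 => /eqP.
have fsum (F : 'I_m -> S) : (forall j, B (F j)) ->
    f (\sum_j F j) = \sum_j f (F j).
  move=> BF; suff [] : B (\sum_j F j) /\ f (\sum_j F j) = \sum_j f (F j) by [].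
  apply: (big_rec2 (fun x y => B x /\ f x = y)); first by split; first exact: subring0.
  by move=> j y x _ [Bx fx]; split; [apply: subringD | rewrite fD ?fx].
have Ba j : B (a j) by apply/AB.
have Bab j : B (a j * b) by apply/AB.
have -> : f b = \sum_j g (a j) * g b * f (z j).
  have {1}-> : b = \sum_j a j * b * z j.
    by under eq_bigr do rewrite mulrAC; rewrite -mulr_suml az1 mul1r.
  rewrite fsum; last by move=> j; apply: subringM.
  by apply: eq_bigr => j _; rewrite fM // (fg _ (Aab j)) gM.
under eq_bigr do rewrite mulrAC.
rewrite -mulr_suml; transitivity (f 1 * g b); last by rewrite f1 mul1r.
congr (_ * _); rewrite -az1 fsum; last by move=> j; apply: subringM.
by apply: eq_bigr => j _; rewrite fM // (fg _ (Aa j)).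
Qed.

(** Multiplying the relations sum a_j z_j = 1 of the single x_i gives products of denominators that
    serve all x_i at once. *)
Lemma locally_denom_common n (x : 'I_n -> S) : (forall i, B (x i)) ->
  exists m (a z : 'I_m -> S),
    [/\ forall j, A (a j), forall i j, A (a j * x i), forall j, B (z j)
      & \sum_j a j * z j = 1].
Proof.
elim: n x => [|n IHn] x Bx.
  exists 1, (fun=> 1), (fun=> 1); split; try by move=> *; exact: subring1.
  - by case.
  - by rewrite big_ord1 mulr1.
have [m [a [z [Aa Aax Bz az1]]]] := IHn (fun i => x (lift ord0 i)) (fun i => Bx _).
have [k [c [w [Ac Acx Bw cw1]]]] := denB (Bx ord0).
pose p (j : 'I_#|{: 'I_m * 'I_k}|) := enum_val j.
exists #|{: 'I_m * 'I_k}|, (fun j => a (p j).1 * c (p j).2), (fun j => z (p j).1 * w (p j).2).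
split=> [j|i j|j|]; try by apply: subringM.
  case: (unliftP ord0 i) => [i' ->|->].
    by rewrite mulrAC; apply: subringM.
  by rewrite -mulrA; apply: subringM.
rewrite -(reindex (@enum_val _ predT) (P := predT)
  (F := fun q => a q.1 * c q.2 * (z q.1 * w q.2))); last first.
  by apply: onW_bij; apply: enum_val_bij.
rewrite -(pair_big predT predT (fun j l => a j * c l * (z j * w l))) /=.
rewrite -[RHS]mulr1 -{1}az1 -cw1 mulr_suml; apply: eq_bigr => j _.
by rewrite mulr_sumr; apply: eq_bigr => l _; ring.
Qed.

(** With common denominators d_j, the expansion x_i = sum (d_j x_i) z_j has coefficients in A, and
    the given relation kills them after scaling by d_j. *)
Lemma locally_denom_flat : flat A B.
Proof.
move=> n a x Aa Bx ax0.
have [m [d [z [Ad Adx Bz dz1]]]] := locally_denom_common Bx.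
exists m, (fun i j => d j * x i), z; split=> // [i|j].
  by under eq_bigr do rewrite mulrAC; rewrite -mulr_suml dz1 mul1r.
by under eq_bigr do rewrite mulrCA; rewrite -mulr_sumr ax0 mulr0.
Qed.

Lemma locally_denom_flat_epi : flat_epi A B.
Proof. by split; [apply: locally_denom_flat | apply: locally_denom_epi]. Qed.

End LocallyDenomFlatEpi.

(** * A quotient model of S (x)_A B, and from flat epimorphisms to denominators *)

Section Tensor.
Variables (S : comPzRingType) (A B : S -> Prop).
Hypotheses (sA : subring A) (sB : subring B) (AB : incl A B) (flatB : flat A B).

(** The equational criterion trivializes one relation; finitely many are handled one after the
    other, starting from the identity matrix. *)
Lemma flat_relations m (z : 'I_m -> S) (L : seq {ffun 'I_m -> S}) :
  (forall j, B (z j)) -> (forall c, c \in L -> forall j, A (c j)) ->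
  (forall c, c \in L -> \sum_j c j * z j = 0) ->
  exists k (D : 'I_m -> 'I_k -> S) (w : 'I_k -> S),
    [/\ forall j l, A (D j l), forall l, B (w l),
        forall j, z j = \sum_l D j l * w l
      & forall c, c \in L -> forall l, \sum_j c j * D j l = 0].
Proof.
move=> Bz; elim: L => [_ _|c L IHL AL L0].
  exists m, (fun j l => (j == l)%:R), z; split=> // [j l|j].
    by case: eqP => _; [apply: subring1 | apply: subring0].
  rewrite (bigD1 j) //= eqxx mul1r big1 ?addr0 // => l /negPf.
  by rewrite eq_sym => ->; rewrite mul0r.
have [||k [D [w [AD Bw zE D0]]]] := IHL.
- by move=> d Ld; apply: AL; rewrite inE Ld orbT.
- by move=> d Ld; apply: L0; rewrite inE Ld orbT.
have Ac : forall j, A (c j) by apply: AL; rewrite mem_head.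
have ADc l : A (\sum_j c j * D j l) by apply: subring_sum => // j; apply: subringM.
(* The relation c among the z_j becomes the relation c D among the w_l. The product D E trivializes
   it and keeps the earlier relations trivial. *)
have [|k' [E [y [AE By wE E0]]]] := flatB ADc Bw.
  transitivity (\sum_j c j * z j); last by apply: L0; rewrite mem_head.
  under eq_bigr do rewrite mulr_suml; rewrite exchange_big; apply: eq_bigr => j _ /=.
  by rewrite zE mulr_sumr; apply: eq_bigr => l _; rewrite mulrA.
have DE0 d : (forall q, \sum_l (\sum_j d j * D j l) * E l q = 0) ->
    forall q, \sum_j d j * \sum_l D j l * E l q = 0.
  move=> dE q; rewrite -[RHS](dE q).
  under eq_bigr do rewrite mulr_sumr; rewrite exchange_big; apply: eq_bigr => l _ /=.
  by rewrite mulr_suml; apply: eq_bigr => j _; rewrite mulrA.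
exists k', (fun j q => \sum_l D j l * E l q), y; split=> // [j q|j|d].
- by apply: subring_sum => // l; apply: subringM.
- rewrite zE; under [RHS]eq_bigr do rewrite mulr_suml.
  rewrite exchange_big; apply: eq_bigr => l _ /=.
  by rewrite wE mulr_sumr; apply: eq_bigr => q _; rewrite mulrA.
- rewrite inE => /predU1P[->|Ld]; first exact: DE0.
  by apply: DE0 => q; rewrite big1 // => l _; rewrite D0 // mul0r.
Qed.

(* A formal sum [:: (x1, y1); ...] stands for the tensor x1 (x) y1 + ... in
   S (x)_A B; [inB] sends the meaningless second components y outside B to 0. *)
Definition inB (y : S) : S := if `[< B y >] then y else 0.

Lemma inB_id y : B y -> inB y = y.
Proof. by rewrite /inB; case: asboolP. Qed.

Lemma inBP y : B (inB y).
Proof. by rewrite /inB; case: asboolP => // _; apply: subring0. Qed.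

(* The equational criterion for the vanishing of a tensor, with the same
   coordinates [c y] for all occurrences of y: this makes invariance under
   permutation and cancellation of opposite terms immediate. *)
Definition null_tensor (s : seq (S * S)) :=
  exists m (z : 'I_m -> S) (c : S -> 'I_m -> S),
    [/\ forall j, B (z j), forall p, p \in s -> forall j, A (c p.2 j),
        forall p, p \in s -> inB p.2 = \sum_j c p.2 j * z j
      & forall j, \sum_(p <- s) p.1 * c p.2 j = 0].

(* Flatness lets us choose the coordinates as a function of y. *)
Lemma null_tensorI m (z : 'I_m -> S) (t : seq (S * S * {ffun 'I_m -> S})) :
  (forall j, B (z j)) -> (forall q, q \in t -> forall j, A (q.2 j)) ->
  (forall q, q \in t -> inB q.1.2 = \sum_j q.2 j * z j) ->
  (forall j, \sum_(q <- t) q.1.1 * q.2 j = 0) ->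
  null_tensor (map fst t).
Proof.
move=> Bz At zE t0.
(* Two coordinate vectors of the same second component differ by a relation among the z_j. Once
   these relations are trivialized by D, the new coordinates depend on y only. *)
pose L := [seq q.1.2 - q.2.2 | q <- [seq (q, q') | q <- t, q' <- t]
             & q.1.1.2 == q.2.1.2].
have LP c : c \in L -> exists q q', [/\ q \in t, q' \in t, q.1.2 = q'.1.2 & c = q.2 - q'.2].
  case/mapP=> -[q q']; rewrite mem_filter => /andP[/eqP /= e].
  by case/allpairsP=> -[u u'] /= [tu tu' [qu qu']] ->; subst; exists u, u'.
have [||k [D [w [AD Bw DE D0]]]] := @flat_relations m z L Bz.
- move=> c /LP[q [q' [tq tq' _ ->]]] j; rewrite !ffunE.
  by apply: subringB => //; apply: At.
- move=> c /LP[q [q' [tq tq' e ->]]].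
  under eq_bigr do rewrite !ffunE mulrBl.
  by rewrite sumrB -zE // -zE // e subrr.
pose q0 : S * S * {ffun 'I_m -> S} := (0, 0, [ffun=> 0]).
(* The first term of t with second component y supplies the coordinates of y; the default [q0] is
   reached only for y absent from t. *)
pose rep y := nth q0 t (find (fun q => q.1.2 == y) t).
pose c y l := \sum_j (rep y).2 j * D j l.
have repP q : q \in t -> rep q.1.2 \in t /\ (rep q.1.2).1.2 = q.1.2.
  move=> tq; have ht : has (fun q' => q'.1.2 == q.1.2) t by apply/hasP; exists q.
  by split; [rewrite mem_nth // -has_find | apply/eqP; apply: (nth_find q0 ht)].
have cE q : q \in t -> forall l, c q.1.2 l = \sum_j q.2 j * D j l.
  move=> tq l; have [tr re] := repP _ tq; apply/eqP; rewrite -subr_eq0 -sumrB.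
  under eq_bigr do rewrite -mulrBl.
  have Lrq : (rep q.1.2).2 - q.2 \in L.
    apply/mapP; exists (rep q.1.2, q) => //; rewrite mem_filter /= re eqxx /=.
    by apply/allpairsP; exists (rep q.1.2, q).
  by rewrite -[X in _ == X](D0 _ Lrq l); apply/eqP/eq_bigr => j _; rewrite !ffunE.
exists k, w, c; split=> // [p /mapP[q tq ->] l|p /mapP[q tq ->]|l].
- by rewrite cE //; apply: subring_sum => // j; apply: subringM => //; apply: At.
- rewrite zE //; under [RHS]eq_bigr do rewrite cE // mulr_suml.
  rewrite exchange_big; apply: eq_bigr => j _; rewrite DE mulr_sumr.
  by apply: eq_bigr => l _; rewrite mulrA.
- rewrite big_map big_seq.
  under eq_bigr do rewrite cE // mulr_sumr.
  rewrite -big_seq exchange_big big1 // => j _ /=.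
  by under eq_bigr do rewrite mulrA; rewrite -mulr_suml t0 mul0r.
Qed.

Definition oppT (s : seq (S * S)) := [seq (- p.1, p.2) | p <- s].

Definition mulT (s u : seq (S * S)) :=
  [seq (p.1 * q.1, inB p.2 * inB q.2) | q <- u, p <- s].

(** Turns rearrangements of formal sums into linear identities between natural numbers, within reach
    of [lia]. *)
Lemma perm_eq_sum (s t : seq (S * S)) :
  (forall F : S * S -> nat, (\sum_(p <- s) F p = \sum_(p <- t) F p)%N) -> perm_eq s t.
Proof.
by move=> st; apply/seq.permP => a; rewrite -!sum1_count [LHS]big_mkcond [RHS]big_mkcond.
Qed.

Lemma null_nil : null_tensor [::].
Proof.
exists 0%N, (fun=> 0), (fun _ _ => 0); split=> // [j|j]; first exact: subring0.
by rewrite big_nil.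
Qed.

Lemma null_perm s t : perm_eq s t -> null_tensor s -> null_tensor t.
Proof.
move=> st [m [z [c [Bz Ac zE s0]]]]; exists m, z, c; split=> // [p|p|j].
- by rewrite -(perm_mem st); apply: Ac.
- by rewrite -(perm_mem st); apply: zE.
- by rewrite -(perm_big _ st).
Qed.

Lemma null_opp s : null_tensor s -> null_tensor (oppT s).
Proof.
move=> [m [z [c [Bz Ac zE s0]]]]; exists m, z, c.
split=> // [_ /mapP[p sp ->]|_ /mapP[p sp ->]|j].
- exact: (Ac p sp).
- exact: (zE p sp).
- by rewrite big_map /=; under eq_bigr do rewrite mulNr; rewrite sumrN s0 oppr0.
Qed.

Lemma null_cancel s t : null_tensor (s ++ (t ++ oppT t)) -> null_tensor s.
Proof.
move=> [m [z [c [Bz Ac zE s0]]]]; exists m, z, c; split=> // [p sp|p sp|j].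
- by apply: Ac; rewrite mem_cat sp.
- by apply: zE; rewrite mem_cat sp.
- rewrite -[RHS](s0 j) !big_cat /= big_map /= -[LHS]addr0; congr (_ + _).
  by rewrite -big_split /= big1 // => p _; rewrite mulNr addrN.
Qed.

(** The two families of generators are juxtaposed. A second component present in both s and t may
    receive two coordinate vectors, which [null_tensorI] reconciles. *)
Lemma null_cat s t : null_tensor s -> null_tensor t -> null_tensor (s ++ t).
Proof.
move=> [m [z [c [Bz Ac zE s0]]]] [n [w [d [Bw Ad wE t0]]]].
pose cl (p : S * S) : {ffun 'I_(m + n) -> S} :=
  [ffun j => match split j with inl i => c p.2 i | inr _ => 0 end].
pose cr (p : S * S) : {ffun 'I_(m + n) -> S} :=
  [ffun j => match split j with inl _ => 0 | inr i => d p.2 i end].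
pose u := [seq (p, cl p) | p <- s] ++ [seq (p, cr p) | p <- t].
have splitl i : split (lshift n i : 'I_(m + n)) = inl i
  by rewrite -[LHS]/(split (unsplit (inl i))) unsplitK.
have splitr i : split (rshift m i : 'I_(m + n)) = inr i
  by rewrite -[LHS]/(split (unsplit (inr i))) unsplitK.
have -> : s ++ t = map fst u by rewrite map_cat -!map_comp !map_id.
apply: (@null_tensorI _ (fun j => match split j with inl i => z i | inr i => w i end)).
- by move=> j; case: split.
- move=> q; rewrite mem_cat => /orP[] /mapP[p sp ->] j; rewrite ffunE /=.
    by case: split => i; [apply: Ac | apply: subring0].
  by case: split => i; [apply: subring0 | apply: Ad].
- move=> q; rewrite mem_cat => /orP[] /mapP[p sp ->] /=; rewrite big_split_ord /=.
    rewrite [X in _ + X]big1 ?addr0 => [|i _]; last by rewrite ffunE splitr mul0r.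
    by rewrite zE //; apply: eq_bigr => i _; rewrite ffunE splitl.
  rewrite [X in X + _]big1 ?add0r => [|i _]; last by rewrite ffunE splitl mul0r.
  by rewrite wE //; apply: eq_bigr => i _; rewrite ffunE splitr.
- move=> j; rewrite big_cat !big_map /=; under eq_bigr do rewrite ffunE.
  under [X in _ + X]eq_bigr do rewrite ffunE.
  case: split => i.
    by rewrite s0 add0r big1 // => p _; rewrite mulr0.
  by rewrite t0 addr0 big1 // => p _; rewrite mulr0.
Qed.

(** Multiplication by a pure tensor q scales the first components by [q.1] and the generators by
    [inB q.2], with the coordinates unchanged. *)
Lemma null_mulr s u : null_tensor s -> null_tensor (mulT s u).
Proof.
move=> s0; elim: u => [|q u IHu]; first exact: null_nil.
rewrite -[mulT _ _]/([seq (p.1 * q.1, inB p.2 * inB q.2) | p <- s] ++ mulT s u).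
apply: null_cat => //.
have [m [z [c [Bz Ac zE {}s0]]]] := s0.
pose cf (p : S * S) : {ffun 'I_m -> S} := [ffun j => c p.2 j].
pose t := [seq ((p.1 * q.1, inB p.2 * inB q.2), cf p) | p <- s].
have -> : [seq (p.1 * q.1, inB p.2 * inB q.2) | p <- s] = map fst t by rewrite -map_comp.
apply: (@null_tensorI _ (fun j => z j * inB q.2)).
- by move=> j; apply: subringM => //; apply: inBP.
- by move=> _ /mapP[p sp ->] j; rewrite ffunE; apply: Ac.
- move=> _ /mapP[p sp ->] /=; rewrite inB_id; last by apply: subringM => //; apply: inBP.
  by rewrite zE // mulr_suml; apply: eq_bigr => j _; rewrite ffunE mulrA.
- move=> j; rewrite big_map /=; under eq_bigr do rewrite ffunE mulrAC.
  by rewrite -mulr_suml s0 mul0r.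
Qed.

Definition tensor_eq (s t : seq (S * S)) : bool := `[< null_tensor (s ++ oppT t) >].

Lemma oppTK s : oppT (oppT s) = s.
Proof.
by rewrite /oppT -map_comp -[RHS]map_id; apply: eq_map => -[x y] /=; rewrite opprK.
Qed.

Lemma null_pair x x' y y' : x + x' = 0 -> inB y = inB y' -> null_tensor [:: (x, y); (x', y')].
Proof.
move=> xx yy; pose o : {ffun 'I_1 -> S} := [ffun=> 1].
have -> : [:: (x, y); (x', y')] = map fst [:: ((x, y), o); ((x', y'), o)] by [].
apply: (@null_tensorI _ (fun=> inB y)).
- by move=> _; apply: inBP.
- by move=> q; rewrite !inE => /orP[] /eqP -> j; rewrite ffunE; apply: subring1.
- by move=> q; rewrite !inE => /orP[] /eqP -> /=; rewrite big_ord1 ffunE mul1r.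
- by move=> j; rewrite !big_cons big_nil addr0 /= !ffunE !mulr1.
Qed.

Lemma null_perm_opp s t : perm_eq s t -> null_tensor (s ++ oppT t).
Proof.
have ss u : null_tensor (u ++ oppT u).
  elim: u => [|[x y] u IHu]; first exact: null_nil.
  apply: null_perm (null_cat (@null_pair x (- x) y y (subrr x) erefl) IHu).
  by apply: perm_eq_sum => F; rewrite /= !big_cons !big_cat /= big_cons; lia.
move=> st; apply: null_perm (ss s); rewrite perm_cat2l.
by apply: perm_map.
Qed.

Lemma tensor_eq_refl : reflexive tensor_eq.
Proof. by move=> s; apply/asboolP/null_perm_opp. Qed.

Lemma tensor_eq_sym : symmetric tensor_eq.
Proof.
suff sym s t : tensor_eq s t -> tensor_eq t s by move=> s t; apply/idP/idP; apply: sym.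
move=> /asboolP/null_opp st; apply/asboolP; apply: null_perm st.
by rewrite /oppT map_cat -/(oppT _) -/(oppT (oppT t)) oppTK perm_catC.
Qed.

Lemma tensor_eq_trans : transitive tensor_eq.
Proof.
move=> t s u /asboolP st /asboolP tu; apply/asboolP; apply: (@null_cancel _ t).
apply: null_perm (null_cat st tu).
apply: perm_eq_sum => F; rewrite !big_cat /=; lia.
Qed.

Canonical tensor_equiv : equiv_rel (seq (S * S)) :=
  EquivRel tensor_eq tensor_eq_refl tensor_eq_sym tensor_eq_trans.

Definition tensor := {eq_quot tensor_equiv}%qT.
HB.instance Definition _ := Choice.on tensor.
HB.instance Definition _ := Quotient.on tensor.
HB.instance Definition _ := EqQuotient.on tensor.

Definition piT (s : seq (S * S)) : tensor := (\pi_tensor s)%qT.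

Lemma tensorW (P : tensor -> Prop) : (forall s, P (piT s)) -> forall x, P x.
Proof. exact: quotW. Qed.

Lemma pi_tensorP s t : piT s = piT t <-> null_tensor (s ++ oppT t).
Proof. by split=> [/eqquotP/asboolP | st]; last by apply/eqquotP/asboolP. Qed.

Lemma pi_tensor_perm s t : perm_eq s t -> piT s = piT t.
Proof. by move=> st; apply/pi_tensorP/null_perm_opp. Qed.

Definition tensor0 : tensor := piT [::].
Definition tensor1 : tensor := piT [:: (1, 1)].
Definition tensor_add (x y : tensor) : tensor := piT (repr x ++ repr y).
Definition tensor_opp (x : tensor) : tensor := piT (oppT (repr x)).
Definition tensor_mul (x y : tensor) : tensor := piT (mulT (repr x) (repr y)).

Lemma null_repr s : null_tensor (s ++ oppT (repr (piT s))).
Proof. by apply/pi_tensorP; rewrite [RHS]reprK. Qed.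

Lemma pi_tensor_add s t : tensor_add (piT s) (piT t) = piT (s ++ t).
Proof.
apply/esym/pi_tensorP; apply: null_perm (null_cat (null_repr s) (null_repr t)).
by rewrite /oppT map_cat; apply: perm_eq_sum => F; rewrite !big_cat /=; lia.
Qed.

Lemma pi_tensor_opp s : tensor_opp (piT s) = piT (oppT s).
Proof.
apply/esym/pi_tensorP; have := null_opp (null_repr s).
by rewrite {1}/oppT map_cat.
Qed.

Lemma big_mulT (F : S * S -> nat) s u :
  (\sum_(p <- mulT s u) F p =
   \sum_(p <- s) \sum_(q <- u) F (p.1 * q.1, inB p.2 * inB q.2)%R)%N.
Proof. by rewrite /mulT big_allpairs_dep exchange_big. Qed.

Lemma perm_mulTC s u : perm_eq (mulT s u) (mulT u s).
Proof.
apply: perm_eq_sum => F; rewrite !big_mulT exchange_big; apply: eq_bigr => p _.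
by apply: eq_bigr => q _; congr (F (_, _)); rewrite mulrC.
Qed.

Lemma pi_tensor_mul s t : tensor_mul (piT s) (piT t) = piT (mulT s t).
Proof.
(* Compatibility in the left factor suffices, as commutativity up to permutation carries it to the
   right factor. *)
have mull u u' v : null_tensor (u ++ oppT u') -> piT (mulT u v) = piT (mulT u' v).
  move=> uu; apply/pi_tensorP; apply: null_perm (null_mulr v uu).
  apply: perm_eq_sum => F; rewrite big_mulT !big_cat /= !big_map !big_mulT.
  congr (_ + _)%N; apply: eq_bigr => p _; apply: eq_bigr => q _ /=.
  by rewrite mulNr.
rewrite /tensor_mul; apply: esym; rewrite (mull _ _ _ (null_repr s)).
rewrite (pi_tensor_perm (perm_mulTC _ _)) (mull _ _ _ (null_repr t)).
exact: (pi_tensor_perm (perm_mulTC _ _)).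
Qed.

Lemma tensor_addA : associative tensor_add.
Proof.
elim/tensorW=> s; elim/tensorW=> t; elim/tensorW=> u.
by rewrite !pi_tensor_add catA.
Qed.

Lemma tensor_addC : commutative tensor_add.
Proof.
elim/tensorW=> s; elim/tensorW=> t.
by rewrite !pi_tensor_add; apply: pi_tensor_perm; rewrite perm_catC.
Qed.

Lemma tensor_add0 : left_id tensor0 tensor_add.
Proof. by elim/tensorW=> s; rewrite pi_tensor_add. Qed.

Lemma tensor_addN : left_inverse tensor0 tensor_opp tensor_add.
Proof.
elim/tensorW=> s; rewrite pi_tensor_opp pi_tensor_add.
apply/pi_tensorP; rewrite cats0; apply: null_perm (null_perm_opp (perm_refl s)).
by rewrite perm_catC.
Qed.

HB.instance Definition _ :=
  GRing.isZmodule.Build tensor tensor_addA tensor_addC tensor_add0 tensor_addN.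

Lemma tensor_mulA : associative tensor_mul.
Proof.
elim/tensorW=> s; elim/tensorW=> t; elim/tensorW=> u.
rewrite !pi_tensor_mul; apply: pi_tensor_perm; apply: perm_eq_sum => F.
rewrite !big_mulT; under [LHS]eq_bigr do rewrite big_mulT.
apply: eq_bigr => p _; apply: eq_bigr => q _; apply: eq_bigr => r _ /=.
have BM x y : inB (inB x * inB y) = inB x * inB y.
  by rewrite inB_id //; apply: subringM => //; apply: inBP.
by rewrite !BM !mulrA.
Qed.

Lemma tensor_mulC : commutative tensor_mul.
Proof.
elim/tensorW=> s; elim/tensorW=> t.
by rewrite !pi_tensor_mul; apply: pi_tensor_perm; apply: perm_mulTC.
Qed.

Lemma tensor_mul1 : left_id tensor1 tensor_mul.
Proof.
elim/tensorW=> s; rewrite pi_tensor_mul; apply/pi_tensorP.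
elim: s => [|[x y] s IHs]; first exact: null_nil.
apply: null_perm (null_cat (@null_pair x (- x) (inB y) y (subrr x) _) IHs); last first.
  by rewrite inB_id //; apply: inBP.
rewrite /mulT /= mul1r (inB_id (subring1 sB)) mul1r -/(mulT _ s).
by apply: perm_eq_sum => F; rewrite /= !big_cons !big_cat /= big_cons; lia.
Qed.

Lemma tensor_mulDl : left_distributive tensor_mul tensor_add.
Proof.
elim/tensorW=> s; elim/tensorW=> t; elim/tensorW=> u.
rewrite pi_tensor_add !pi_tensor_mul pi_tensor_add; apply: pi_tensor_perm.
by apply: perm_eq_sum => F; rewrite big_cat /= !big_mulT big_cat.
Qed.

HB.instance Definition _ :=
  GRing.Zmodule_isComPzRing.Build tensor
    tensor_mulA tensor_mulC tensor_mul1 tensor_mulDl.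

(** The maps x to x (x) 1 and y to 1 (x) y agree on A, hence at b. The vanishing of b (x) 1 - 1 (x)
    b provides coordinates in A with 1 = sum c(1)_j z_j and b c(1)_j = c(b)_j, so the c(1)_j are
    denominators of b. *)
Lemma flat_epi_locally_denom b : epi A B -> B b -> locally_denom A B b.
Proof.
move=> epiAB Bb; have B1 := subring1 sB; have A1 := subring1 sA.
pose f x : tensor := piT [:: (x, 1)]; pose g y : tensor := piT [:: (1, y)].
have fmorph : rmorph_on B f.
  split=> // x y _ _.
    rewrite [RHS]pi_tensor_add; apply/pi_tensorP.
    exists 1%N, (fun=> 1), (fun _ _ => 1); split=> // [p|j].
      by rewrite !inE => /or3P[] /eqP ->; rewrite /= big_ord1 mulr1 inB_id.
    by rewrite !big_cons big_nil /=; ring.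
  by rewrite [RHS]pi_tensor_mul /mulT /= inB_id // mulr1.
have gmorph : rmorph_on B g.
  split=> // x y Bx By.
    rewrite [RHS]pi_tensor_add; apply/pi_tensorP.
    (* Unit vectors, for coordinates with respect to the generators x and y. *)
    pose d (i : 'I_2) : {ffun 'I_2 -> S} := [ffun j => (i == j)%:R].
    pose t : seq (S * S * {ffun 'I_2 -> S}) :=
      [:: ((1, x + y), d ord0 + d ord_max); ((- 1, x), d ord0); ((- 1, y), d ord_max)].
    rewrite -[[:: _] ++ _]/(map fst t).
    apply: (@null_tensorI _ (fun j => if j == ord0 then x else y)).
    - by move=> j; case: ifP.
    - have Ad i j : A (d i j) by rewrite ffunE; case: eqP => _ //; apply: subring0.
      by move=> q; rewrite !inE => /or3P[] /eqP -> j //=; rewrite ffunE; apply: subringD.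
    - move=> q; rewrite !inE => /or3P[] /eqP -> /=;
        rewrite big_ord_recl big_ord1 !ffunE /= inB_id //.
      + by ring.
      + exact: subringD.
      + by ring.
      + by ring.
    - by move=> j; rewrite !big_cons big_nil /= ffunE; ring.
  by rewrite [RHS]pi_tensor_mul /mulT /= !inB_id // mulr1.
have fg a : A a -> f a = g a.
  move=> Aa; apply/pi_tensorP.
  pose t : seq (S * S * {ffun 'I_1 -> S}) := [:: ((a, 1), [ffun=> 1]); ((- 1, a), [ffun=> a])].
  rewrite -[[:: _] ++ _]/(map fst t).
  apply: (@null_tensorI _ (fun=> 1)) => //.
  - by move=> q; rewrite !inE => /orP[] /eqP -> j; rewrite ffunE.
  - move=> q; rewrite !inE => /orP[] /eqP -> /=; rewrite big_ord1 ffunE mulr1 inB_id //.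
    exact: AB.
  - by move=> j; rewrite !big_cons big_nil /= !ffunE; ring.
have /pi_tensorP[m [z [c [Bz Ac zE c0]]]] := epiAB _ f g fmorph gmorph fg b Bb.
exists m, (c 1), z; split=> // [j|j|].
- by apply: (Ac (b, 1)); rewrite mem_head.
- have := c0 j; rewrite !big_cons big_nil /= addr0 mulN1r => /eqP.
  rewrite subr_eq0 mulrC => /eqP ->.
  by apply: (Ac (- 1, b)); rewrite !inE eqxx orbT.
- by rewrite -(zE (b, 1)) ?mem_head //= inB_id.
Qed.

End Tensor.

(** * Integral elements *)

Section Cayley.
Variables (S : comPzRingType) (J : S -> Prop) (x : S).
Hypotheses (J0 : J 0) (JB : forall u v, J u -> J v -> J (u - v))
  (JM : forall u v, J u -> J v -> J (u * v)).

(* [low k y]: y is a combination of 1, x, ..., x^(k-1) with coefficients in J. *)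
Fixpoint low k (y : S) : Prop :=
  if k is k'.+1 then exists r y', [/\ J r, low k' y' & y = r + x * y'] else y = 0.

Lemma rng_closedD u v : J u -> J v -> J (u + v).
Proof. by move=> Ju Jv; rewrite -[v]opprK -[- v]sub0r; apply/JB/JB. Qed.

Lemma low0 k : low k 0.
Proof. by elim: k => //= k IHk; exists 0, 0; rewrite mulr0 addr0. Qed.

Lemma lowB k y z : low k y -> low k z -> low k (y - z).
Proof.
elim: k y z => [|k IHk] y z /=; first by move=> -> ->; rewrite subr0.
move=> [r [y' [Jr ly ->]]] [s [z' [Js lz ->]]].
exists (r - s), (y' - z'); split; [exact: JB | exact: IHk | ring].
Qed.

Lemma lowN k y : low k y -> low k (- y).
Proof. by rewrite -sub0r; apply/lowB/low0. Qed.

Lemma lowD k y z : low k y -> low k z -> low k (y + z).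
Proof. by move=> ly lz; rewrite -[z]opprK; apply/lowB/lowN. Qed.

Lemma low_scale k r y : J r -> low k y -> low k (r * y).
Proof.
move=> Jr; elim: k y => [|k IHk] y /=; first by move->; rewrite mulr0.
move=> [s [y' [Js ly ->]]]; exists (r * s), (r * y').
by split; [exact: JM | exact: IHk | ring].
Qed.

Lemma low_widen k m y : (k <= m)%N -> low k y -> low m y.
Proof.
elim: k m y => [|k IHk] [|m] y //=; first by move=> _ ->; apply: (low0 m.+1).
by rewrite ltnS => km [r [y' [Jr ly ->]]]; exists r, y'; split=> //; apply: IHk ly.
Qed.

Lemma low_mulX k m y : low k y -> low (m + k) (x ^+ m * y).
Proof.
move=> ly; elim: m => [|m IHm]; first by rewrite mul1r.
by exists 0, (x ^+ m * y); rewrite exprS; split=> //; ring.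
Qed.

Lemma low_mul k m y z : low k y -> low m z -> low (k + m) (y * z).
Proof.
move=> + lz; elim: k y => [|k IHk] y.
  by move=> /= ->; rewrite mul0r; apply: low0.
move=> [r [y' [Jr ly ->]]]; rewrite mulrDl -mulrA; apply: lowD.
  by apply: (low_widen (k := m)); [lia | apply: low_scale].
by exists 0, (y' * z); split=> //; [apply: IHk | ring].
Qed.

Lemma low_sum k (I : Type) (r : seq I) (P : pred I) F :
  (forall i, P i -> low k (F i)) -> low k (\sum_(i <- r | P i) F i).
Proof. by move=> lF; apply: big_ind => //; [apply: low0 | apply: lowD]. Qed.

Lemma low_coef k y : low k y ->
  exists c : 'I_k -> S, (forall i, J (c i)) /\ y = \sum_i c i * x ^+ i.
Proof.
elim: k y => [|k IHk] y /=; first by move->; exists (fun=> 0); rewrite big_ord0.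
move=> [r [y' [Jr /IHk[c [Jc ->]] ->]]].
exists (fun i => if unlift ord0 i is Some j then c j else r); split.
  by move=> i; case: unlift.
rewrite big_ord_recl unlift_none mulr1 mulr_sumr; congr (_ + _).
by apply: eq_bigr => i _; rewrite liftK exprS mulrCA.
Qed.

Lemma low1 r : J r -> low 1 r.
Proof. by move=> Jr; exists r, 0; rewrite mulr0 addr0. Qed.

(** The leading coefficient is a boolean rather than an element of J, since 1 may lie outside J. *)
Let almost_low (e : bool) k y := exists l, low k l /\ y = e%:R * x ^+ k + l.

Lemma almost_low_prod (I : Type) (r : seq I) (e : I -> bool) (F : I -> S) :
  (forall i, almost_low (e i) 1 (F i)) ->
  almost_low (all e r) (size r) (\prod_(i <- r) F i).
Proof.
move=> eF; elim: r => [|i r [l [ll IHr]]] /=.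
  by exists 0; rewrite big_nil mulr1 addr0.
have [l' [ll' Fi]] := eF i; rewrite big_cons Fi IHr /=.
exists ((e i)%:R * (x ^+ 1 * l) + (all e r)%:R * (x ^+ size r * l') + l' * l).
have ltb (b : bool) k y : low k y -> low k (b%:R * y).
  by case: b => ly; rewrite ?mul1r // mul0r; apply: low0.
split; last first.
  by rewrite (exprS x (size r)) expr1; case: (e i); case: (all e r);
    rewrite /= ?mulr0n ?mulr1n; ring.
apply: lowD; last by rewrite -add1n; apply: low_mul.
apply: lowD; first by apply/ltb; rewrite -add1n; apply: low_mulX.
by apply/ltb; rewrite -addn1; apply: low_mulX.
Qed.

(** In the Leibniz expansion only the identity permutation takes x from every row; all other terms
    have lower degree in x. *)
Lemma det_low n (A : 'M[S]_n) : (forall i j, J (A i j)) ->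
  exists l, low n l /\ \det (x%:M - A) = x ^+ n + l.
Proof.
move=> JA; have term (s : 'S_n) :
    almost_low (s == 1%g) n (\prod_i (x%:M - A) i (s i)).
  have -> : (s == 1%g) = all (fun i => i == s i) (enum 'I_n).
    apply/eqP/allP => [-> i _|si]; first by rewrite perm1.
    by apply/permP=> i; rewrite perm1 -(eqP (si i _)) // mem_enum.
  rewrite -big_enum /=.
  have := @almost_low_prod _ (enum 'I_n) (fun i => i == s i) (fun i => (x%:M - A) i (s i)).
  rewrite size_enum_ord; apply=> i.
  exists (- A i (s i)); split; last by rewrite !mxE expr1 mulr_natl.
  by apply: low1; rewrite -sub0r; apply: JB.
exists (\det (x%:M - A) - x ^+ n); split; last by ring.
rewrite /determinant (bigD1 (1%g : {perm 'I_n})) //= odd_perm1 mul1r.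
have [l [ll ->]] := term 1%g.
rewrite eqxx mul1r -[x ^+ n + l + _]addrA [x ^+ n + _]addrC addrK.
apply: lowD => //; apply: low_sum => s s1; have [l' [ll' ->]] := term s.
rewrite (negPf s1) mul0r add0r.
by case: (s : bool); rewrite ?expr0 ?expr1 ?mulN1r ?mul1r //; apply: lowN.
Qed.

(** By the adjugate, det(x - A) kills every g_i, hence kills 1 = sum c_i g_i and is zero. The c_i
    are arbitrary in S. *)
Lemma cayley_low n (A : 'M[S]_n) (g c : 'I_n -> S) : (forall i j, J (A i j)) ->
  (forall i, x * g i = \sum_j A i j * g j) -> \sum_i c i * g i = 1 ->
  low n (x ^+ n).
Proof.
move=> JA xg cg1; have [l [ll dl]] := det_low JA.
pose G := \col_i g i; have MG : (x%:M - A) *m G = 0.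
  apply/matrixP=> i j; rewrite mulmxBl mul_scalar_mx !mxE xg.
  by under [X in _ - X]eq_bigr do rewrite mxE; rewrite subrr.
have dg i : \det (x%:M - A) * g i = 0.
  have := congr1 (mulmx (\adj (x%:M - A))) MG.
  rewrite mulmxA mul_adj_mx mulmx0 mul_scalar_mx => /matrixP/(_ i 0).
  by rewrite !mxE.
have d0 : \det (x%:M - A) = 0.
  rewrite -[LHS]mulr1 -cg1 mulr_sumr big1 // => i _.
  by rewrite mulrCA dg mulr0.
have -> : x ^+ n = - l by apply/eqP; rewrite -addr_eq0 -dl d0.
exact: lowN.
Qed.

End Cayley.

(** * Finitely generated modules and integral elements *)

Section Span.
Variables (S : comPzRingType) (R : S -> Prop).
Hypothesis sR : subring R.

Fixpoint span (g : seq S) (y : S) : Prop :=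
  if g is a :: g' then exists r y', [/\ R r, span g' y' & y = r * a + y'] else y = 0.

Definition stable g d := forall u, span g u -> span g (d * u).

Lemma span0 g : span g 0.
Proof.
by elim: g => //= a g IHg; exists 0, 0; rewrite mul0r addr0; split=> //; apply: subring0.
Qed.

Lemma spanB g u v : span g u -> span g v -> span g (u - v).
Proof.
elim: g u v => [|a g IHg] u v /=; first by move=> -> ->; rewrite subr0.
move=> [r [u' [Rr gu ->]]] [s [v' [Rs gv ->]]]; exists (r - s), (u' - v').
by split; [apply: subringB | apply: IHg | ring].
Qed.

Lemma spanD g u v : span g u -> span g v -> span g (u + v).
Proof.
move=> gu gv; rewrite -[v]opprK -[- v]sub0r; apply: spanB => //.
by apply: spanB => //; apply: span0.
Qed.

Lemma span_scale g r : R r -> stable g r.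
Proof.
move=> Rr; elim: g => [|a g IHg] u /=; first by move->; rewrite mulr0.
move=> [s [u' [Rs gu ->]]]; exists (r * s), (r * u').
by split; [apply: subringM | apply: IHg | ring].
Qed.

Lemma span_cat g h y :
  span (g ++ h) y <-> exists u v, [/\ span g u, span h v & y = u + v].
Proof.
elim: g y => [|a g IHg] y /=.
  by split=> [hy|[u [v [-> hv ->]]]]; [exists 0, y|]; rewrite add0r.
split=> [[r [y' [Rr /IHg[u [v [gu hv ->]]] ->]]]|].
  by exists (r * a + u), v; rewrite addrA; split=> //; exists r, u.
move=> [_ [v [[r [u [Rr gu ->]]] hv ->]]]; exists r, (u + v); rewrite addrA; split=> //.
by apply/IHg; exists u, v.
Qed.

Lemma span_map g x y : span (map ( *%R x) g) y <-> exists2 u, span g u & y = x * u.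
Proof.
elim: g y => [|a g IHg] y /=.
  by split=> [->|[u -> ->]]; [exists 0|]; rewrite ?mulr0.
split=> [[r [y' [Rr /IHg[u gu ->] ->]]]|[_ [r [u [Rr gu ->]]] ->]].
  by exists (r * a + u); [exists r, u | ring].
by exists r, (x * u); split=> //; [apply/IHg; exists u | ring].
Qed.

Lemma span_coef g y : span g y ->
  exists c : 'I_(size g) -> S, (forall i, R (c i)) /\ y = \sum_i c i * g`_i.
Proof.
elim: g y => [|a g IHg] y /=; first by move->; exists (fun=> 0); split; [case|rewrite big_ord0].
move=> [r [y' [Rr /IHg[c [Rc ->]] ->]]].
exists (fun i => if unlift ord0 i is Some j then c j else r); split.
  by move=> i; case: unlift.
rewrite big_ord_recl unlift_none; congr (_ + _).
by apply: eq_bigr => i _; rewrite liftK.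
Qed.

Lemma span_nth g (i : 'I_(size g)) : span g g`_i.
Proof.
elim: g i => [[]//|a g IHg] i; case: (unliftP ord0 i) => [j|] -> /=.
  by exists 0, g`_j; rewrite mul0r add0r; split=> //; apply: subring0.
by exists 1, 0; rewrite mul1r addr0; split=> //; [apply: subring1 | apply: span0].
Qed.

(** Multiplication by x on the generators has a matrix over R, so Cayley-Hamilton yields a monic
    equation. *)
Lemma stable_integral g x : span g 1 -> stable g x -> integral R x.
Proof.
move=> /span_coef[c [Rc c1]] gx.
have /fin_all_exists[A AP] (i : 'I_(size g)) : exists a : 'I_(size g) -> S,
    (forall j, R (a j)) /\ x * g`_i = \sum_j a j * g`_j.
  by apply/span_coef/gx/span_nth.
have xn : low R x (size g) (x ^+ size g).
  apply: (@cayley_low _ _ _ _ _ _ _ (\matrix_(i, j) A i j) (fun i => g`_i) c).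
  - exact: subring0.
  - exact: subringB.
  - exact: subringM.
  - by move=> i j; rewrite mxE; apply: (AP i).1.
  - by move=> i; rewrite (AP i).2; apply: eq_bigr => j _; rewrite mxE.
  - by rewrite -c1.
have [d [Rd xd]] := low_coef (subring0 sR) xn; exists (size g), (fun i => - d i); split.
  by move=> i; apply: subringN.
rewrite {1}xd -big_split big1 // => i _ /=; ring.
Qed.

(* Generators of N + x N + ... + x^(n-1) N, where N is spanned by g. *)
Fixpoint power_gens (g : seq S) (x : S) n :=
  if n is n'.+1 then power_gens g x n' ++ map ( *%R (x ^+ n')) g else [::].

Lemma span_power_gens g x n y : span (power_gens g x n) y <->
  exists u : nat -> S, (forall i, span g (u i)) /\ y = \sum_(i < n) x ^+ i * u i.
Proof.
elim: n y => [|n IHn] y.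
  split=> [/= ->|[u [_]]]; last by rewrite big_ord0.
  by exists (fun=> 0); rewrite big_ord0; split=> // _; apply: span0.
split=> [/span_cat[v [w [/IHn[u [gu ->]] /span_map[t gt ->] ->]]]|[u [gu ->]]].
  exists (fun i => if (i < n)%N then u i else t); split=> [i|]; first by case: ifP.
  rewrite big_ord_recr /= ltnn; congr (_ + _).
  by apply: eq_bigr => i _; rewrite ltn_ord.
rewrite big_ord_recr; apply/span_cat; exists (\sum_(i < n) x ^+ i * u i), (x ^+ n * u n).
by split=> //; [apply/IHn; exists u | apply/span_map; exists (u n)].
Qed.

(** The coefficients c_i need only stabilize the module N spanned by g. This covers coefficients in
    R as well as integral ones, and the latter give transitivity. *)
Lemma stable_adjoin g x n (c : 'I_n -> S) :
  span g 1 -> (forall i, stable g (c i)) -> x ^+ n + \sum_i c i * x ^+ i = 0 ->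
  exists g', [/\ span g' 1, stable g' x & forall d, stable g d -> stable g' d].
Proof.
move=> g1 gc xn; exists (power_gens g x n); split.
(* In degree 0 the integral equation reads 1 = 0. *)
- apply/span_power_gens; case: n c gc xn => [|n] c gc xn.
    exists (fun=> 0); split=> [i|]; first exact: span0.
    by move: xn; rewrite !big_ord0 addr0 => <-.
  exists (fun i => if i is 0%N then 1 else 0).
  split=> [[|i]|]; [by [] | exact: span0 |].
  by rewrite big_ord_recl mulr1 expr0 big1 ?addr0 // => i _; rewrite mulr0.
- move=> y /span_power_gens[u [gu ->]]; apply/span_power_gens.
  case: n c gc xn => [|n] c gc xn.
    by exists (fun=> 0); rewrite !big_ord0 mulr0; split=> // i; apply: span0.
  (* Multiplication by x shifts the components u_j by one; the overflow x^(n+1) u_n is replaced by -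
     sum c_i x^i u_n. *)
  exists (fun i => (if i is j.+1 then u j else 0) -
            (if insub i is Some k then c k else 0) * u n).
  split=> [i|].
    apply: spanB; first by case: i => // ; apply: span0.
    by case: insub => [k|]; [apply: gc | rewrite mul0r; apply: span0].
  under [RHS]eq_bigr do rewrite mulrBr valK.
  rewrite sumrB [X in _ = X - _]big_ord_recl /= mulr0 add0r.
  rewrite mulr_sumr big_ord_recr /= mulrA -exprS; congr (_ + _).
    by apply: eq_bigr => i _; rewrite mulrA -exprS.
  have -> : x ^+ n.+1 = - \sum_i c i * x ^+ i by apply/eqP; rewrite -addr_eq0 xn.
  rewrite mulNr mulr_suml; congr (- _); apply: eq_bigr => i _; ring.
- move=> d gd y /span_power_gens[u [gu ->]]; apply/span_power_gens.
  exists (fun i => d * u i); split=> [i|]; first exact: gd.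
  by rewrite mulr_sumr; apply: eq_bigr => i _; rewrite mulrCA.
Qed.

Lemma integral_stable (cs : seq S) : (forall c, c \in cs -> integral R c) ->
  exists g, span g 1 /\ forall c, c \in cs -> stable g c.
Proof.
elim: cs => [_|c cs IHcs intc].
  exists [:: 1]; split=> //=; exists 1, 0; rewrite mulr1 addr0; split=> //.
  exact: subring1.
have [|g [g1 gcs]] := IHcs; first by move=> d csd; apply: intc; rewrite inE csd orbT.
have [n [a [Ra an]]] := intc c (mem_head _ _).
have [//|g' [g'1 g'c g'd]] := stable_adjoin g1 _ an.
  by move=> i; apply: span_scale.
exists g'; split=> // d; rewrite inE => /predU1P[->//|csd].
by apply/g'd/gcs.
Qed.

Lemma subring_integral : subring (integral R).
Proof.
have two x y : integral R x -> integral R y ->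
    exists g, [/\ span g 1, stable g x & stable g y].
  move=> ix iy; have [|g [g1 gc]] := @integral_stable [:: x; y].
    by move=> c; rewrite !inE => /orP[] /eqP ->.
  by exists g; split=> //; [apply: (gc x) | apply: (gc y)]; rewrite !inE eqxx ?orbT.
split.
- exists 1%N, (fun=> - 1); split=> [_|]; first by apply/(subringN sR)/(subring1 sR).
  by rewrite big_ord1; ring.
- move=> x y ix iy; have [g [g1 gx gy]] := two x y ix iy.
  apply: (stable_integral g1) => u gu; rewrite mulrBl.
  by apply: spanB; [apply: gx | apply: gy].
- move=> x y ix iy; have [g [g1 gx gy]] := two x y ix iy.
  by apply: (stable_integral g1) => u gu; rewrite -mulrA; apply/gx/gy.
Qed.

(** The coefficients of the equation of x stabilize a common finitely generated R-module containing
    1, to which x is then adjoined. *)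
Lemma integral_trans x : integral (integral R) x -> integral R x.
Proof.
move=> [n [c [ic xn]]]; have [|g [g1 gc]] := @integral_stable (codom c).
  by move=> d /codomP[i ->].
have [//|g' [g'1 g'x _]] := stable_adjoin g1 _ xn.
  by move=> i; apply/gc/codom_f.
exact: stable_integral g'1 g'x.
Qed.

Lemma integral_incl x : R x -> integral R x.
Proof.
move=> Rx; exists 1%N, (fun=> - x); split=> [_|]; first exact: subringN.
by rewrite big_ord1; ring.
Qed.

(* Nakayama's lemma, that is, Cayley-Hamilton for the identity endomorphism of
   J R[y_0, ..., y_(m-1)] = R[y_0, ..., y_(m-1)]. *)
Lemma integral_ideal1 (J : S -> Prop) m (r y : 'I_m -> S) :
  J 0 -> incl J R -> (forall u v, J u -> J v -> J (u - v)) ->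
  (forall a u, R a -> J u -> J (a * u)) ->
  (forall j, J (r j)) -> (forall j, integral R (y j)) -> \sum_j r j * y j = 1 -> J 1.
Proof.
move=> J0 JR JB JZ Jr iy ry1.
have [|g [g1 gy]] := @integral_stable (codom y); first by move=> d /codomP[i ->].
have [c [Rc c1]] := span_coef g1.
have /fin_all_exists[A AP] (q : 'I_(size g) * 'I_m) : exists a : 'I_(size g) -> S,
    (forall l, R (a l)) /\ y q.2 * g`_q.1 = \sum_l a l * g`_l.
  by apply/span_coef/gy; [apply: codom_f | apply: span_nth].
have Jsum (F : 'I_m -> S) : (forall j, J (F j)) -> J (\sum_j F j).
  by move=> JF; apply: big_ind => // u v Ju Jv; apply: rng_closedD.
have lowJ k u : low J 1 k u -> J u.
  elim: k u => [|k IHk] u /=; first by move->.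
  by move=> [s [u' [Js /IHk Ju ->]]]; rewrite mul1r; apply: rng_closedD.
rewrite -(expr1n S (size g)); apply: (lowJ (size g)).
(* Expanding g_i = sum r_j (y_j g_i) represents multiplication by 1 by a matrix with entries in
   J. *)
apply: (@cayley_low _ _ _ _ _ _ _ (\matrix_(i, l) \sum_j A (i, j) l * r j)
    (fun i => g`_i) c) => //.
- by move=> u v /JR Ru Jv; apply: JZ.
- by move=> i l; rewrite mxE; apply: Jsum => j; apply: JZ => //; apply: (AP (i, j)).1.
- move=> i; rewrite -{1}ry1 mulr_suml.
  under [RHS]eq_bigr do rewrite mxE mulr_suml.
  rewrite exchange_big; apply: eq_bigr => j _ /=.
  rewrite -mulrA (AP (i, j)).2 mulr_sumr; apply: eq_bigr => l _; ring.
Qed.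

End Span.

(** * Prüfer extensions *)

Section Content.
Variables (S : comPzRingType) (R : S -> Prop).
Hypothesis sR : subring R.

(* (R : t) + (R : t) t; it contains 1 iff R + R t is an invertible R-module. *)
Definition denom_sum (t y : S) :=
  exists a b, [/\ R a, R b, R (a * t), R (b * t) & y = a + b * t].

Lemma denom_sumD t y z : denom_sum t y -> denom_sum t z -> denom_sum t (y + z).
Proof.
move=> [a [b [Ra Rb Rat Rbt ->]]] [c [d [Rc Rd Rct Rdt ->]]].
exists (a + c), (b + d); split; try by rewrite ?mulrDl; apply: subringD.
ring.
Qed.

Lemma denom_sum_scale t r y : R r -> denom_sum t y -> denom_sum t (r * y).
Proof.
move=> Rr [a [b [Ra Rb Rat Rbt ->]]].
exists (r * a), (r * b); split; try by rewrite -?mulrA; apply: subringM.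
ring.
Qed.

(* The Horner partial sums b of the polynomial lie in (R : t), because b t is
   integral over R; every coefficient is a difference of the form b - b' t. *)
Lemma coef_denom_sum (T : S -> Prop) t n (c : nat -> S) :
  subring T -> incl R T -> (forall x, T x -> integral R x -> R x) -> T t ->
  (forall i, R (c i)) -> \sum_(i < n.+1) c i * t ^+ i = 0 ->
  forall i, (i <= n)%N -> denom_sum t (c i).
Proof.
move=> sT RT icR Tt; have R0 := subring0 sR.
elim: n c => [|n IHn] c Rc.
  rewrite big_ord1 mulr1 => c0 i; rewrite leqn0 => /eqP ->; rewrite c0.
  by exists 0, 0; rewrite !mul0r addr0.
rewrite big_ord_recr /=; set b := c n.+1 => ct0.
have Rbt : R (b * t).
  apply: icR; first by apply: subringM => //; apply: RT; apply: Rc.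
  (* Multiplying the relation by b^n, with b its leading coefficient, makes it a monic equation for
     b t. *)
  exists n.+1, (fun i => c i * b ^+ (n - i)); split=> [i|].
    by apply: subringM => //; apply: subringX => //; apply: Rc.
  transitivity (b ^+ n * (\sum_(i < n.+1) c i * t ^+ i + b * t ^+ n.+1));
    last by rewrite ct0 mulr0.
  rewrite mulrDr addrC mulr_sumr; congr (_ + _); last by rewrite exprMn exprS; ring.
  apply: eq_bigr => i _; rewrite exprMn.
  have -> : b ^+ n = b ^+ (n - i) * b ^+ i by rewrite -exprD subnK // -ltnS.
  ring.
(* One Horner step: the top term b t^(n+1) is absorbed into the coefficient of t^n. *)
pose c' i := if i == n then c n + b * t else c i.
have Kb : denom_sum t b.
  by exists b, 0; rewrite !mul0r addr0; split=> //; apply: Rc.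
have Kbt : denom_sum t (- (b * t)).
  exists 0, (- b); rewrite mul0r add0r mulNr; split=> //; apply: subringN => //.
  exact: Rc.
have Kc' : forall i, (i <= n)%N -> denom_sum t (c' i).
  apply: IHn => [i|]; first by rewrite /c'; case: eqP => // _; apply: subringD.
  rewrite -[RHS]ct0 !big_ord_recr /= /c' eqxx.
  under eq_bigr => i _ do rewrite (ltn_eqF (ltn_ord i)).
  by rewrite (exprS t n); ring.
move=> i; rewrite leq_eqVlt => /predU1P[->//|]; rewrite ltnS => ilen.
have := Kc' i ilen; rewrite /c'; case: eqP => [->|//] Kn.
by rewrite -[c n](addrK (b * t)); apply: denom_sumD.
Qed.

(** If 1 = a + b u with a and b in (R : u), then a and b are denominators of u with multipliers 1
    and u, which lie in every U containing u. *)
Lemma denom_sum_prufer (B : S -> Prop) :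
  (forall t, B t -> denom_sum t 1) -> prufer R B.
Proof.
move=> Bt U [sU RU UB]; apply: locally_denom_flat_epi => // u Uu.
have [a [b [Ra Rb Rau Rbu ab1]]] := Bt u (UB _ Uu).
exists 2%N, (fun j => if j == ord0 then a else b), (fun j => if j == ord0 then 1 else u).
split=> [j|j|j|]; try by case: eqP.
- by case: eqP => // _; apply: subring1.
- by rewrite big_ord_recl big_ord1 /= mulr1 -ab1.
Qed.

End Content.

(** * Elements of a Prüfer extension *)

Section PruferElements.
Variables (S : comPzRingType) (R T : S -> Prop).
Hypotheses (sR : subring R) (sT : subring T) (RT : incl R T) (prufRT : prufer R T).

Let R0 := subring0 sR.
Let RB := subringB sR.
Let RM := subringM sR.

Lemma subring_adjoin x : subring (fun y => exists k, low R x k y).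
Proof.
split.
- by exists 1%N; apply: low1 => //; apply: subring1.
- move=> y z [k ly] [m lz]; exists (k + m)%N.
  apply: lowB => //; first by apply: low_widen ly => //; apply: leq_addr.
  by apply: low_widen lz => //; apply: leq_addl.
- by move=> y z [k ly] [m lz]; exists (k + m)%N; apply: low_mul.
Qed.

Lemma sub_adjoin x r : R r -> exists k, low R x k r.
Proof. by exists 1%N; apply: low1. Qed.

Lemma mem_adjoin x : exists k, low R x k x.
Proof.
exists 2%N, 0, 1; split=> //; last by rewrite mulr1 add0r.
by apply: low1 => //; apply: subring1.
Qed.

Lemma low_incl (U : S -> Prop) x k y :
  subring U -> incl R U -> U x -> low R x k y -> U y.
Proof.
move=> sU RU Ux; elim: k y => [|k IHk] y; first by move=> /= ->; apply: subring0.
move=> [r [y' [Rr /IHk Uy ->]]]; apply: subringD => //; first exact: RU.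
exact: subringM.
Qed.

(** Applying the Prüfer property to R[t] makes the multipliers polynomials in t. *)
Lemma prufer_locally_denom t : T t ->
  locally_denom R (fun y => exists k, low R t k y) t.
Proof.
move=> Tt; have Rt : subring (fun y => exists k, low R t k y) := subring_adjoin t.
have inc : incl R (fun y => exists k, low R t k y) by move=> r; apply: sub_adjoin.
have [|fl ep] := prufRT (U := fun y => exists k, low R t k y).
  by split=> // y [k]; apply: low_incl.
by apply: flat_epi_locally_denom => //; apply: mem_adjoin.
Qed.

(** The ideal (R : x) generates the unit ideal of R[x], which is integral over R; Nakayama then puts
    1 in (R : x). *)
Lemma prufer_int_closed x : T x -> integral R x -> R x.
Proof.
move=> Tx ix; have [m [a [z [Ra Rax Rz az1]]]] := prufer_locally_denom Tx.
suff [_] : R 1 /\ R (1 * x) by rewrite mul1r.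
apply: (@integral_ideal1 S R sR (fun a => R a /\ R (a * x)) m a z) => //.
- by rewrite mul0r.
- by move=> u [].
- by move=> u v [Ru Rux] [Rv Rvx]; rewrite mulrBl; split; apply: RB.
- by move=> r u Rr [Ru Rux]; rewrite -mulrA; split; apply: RM.
- move=> j; have [k lz] := Rz j; apply: (low_incl _ _ ix lz).
    exact: subring_integral.
  by move=> r; apply: integral_incl.
Qed.

Lemma low_even_odd t k y : low R t k y -> exists p q,
  [/\ exists k', low R (t ^+ 2) k' p, exists k', low R (t ^+ 2) k' q & y = p + q * t].
Proof.
have sE := subring_adjoin (t ^+ 2); have tE := mem_adjoin (t ^+ 2).
elim: k y => [|k IHk] y.
  by move=> /= ->; exists 0, 0; rewrite mul0r addr0; split=> //; apply: (subring0 sE).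
move=> [r [y' [Rr /IHk[p [q [Ep Eq ->]]] ->]]]; exists (r + t ^+ 2 * q), p.
split=> //; last by ring.
apply: (subringD sE); first exact: sub_adjoin.
exact: (subringM sE).
Qed.

(** The absence of a linear term gives t - y the coefficient 1 at t. *)
Lemma low_sqr_coef t k y : low R (t ^+ 2) k y -> exists d : nat -> S,
  [/\ forall i, R (d i), d 1%N = 0 & y = \sum_(i < k.*2) d i * t ^+ i].
Proof.
elim: k y => [|k IHk] y.
  by move=> /= ->; exists (fun=> 0); rewrite big_ord0.
move=> [r [y' [Rr /IHk[d [Rd d1 ->]] ->]]].
exists (fun i => if i is j.+2 then d j else if i is 0%N then r else 0).
split=> // [[|[|i]] //|].
rewrite doubleS !big_ord_recl /= mulr1 mul0r add0r; congr (_ + _).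
by rewrite mulr_sumr; apply: eq_bigr => i _; rewrite /bump /= !add1n !exprS expr0; ring.
Qed.

(* As t is integral over R[t^2], it lies in R[t^2]: this is a polynomial
   relation for t over R with a coefficient equal to 1. *)
Lemma prufer_denom_sum t : T t -> denom_sum R t 1.
Proof.
move=> Tt; have [m [a [z [Ra Rat Rz az1]]]] := prufer_locally_denom Tt.
set E := fun y => exists k, low R (t ^+ 2) k y.
have sE : subring E := subring_adjoin (t ^+ 2).
have RE r : R r -> E r by apply: sub_adjoin.
have Et2 : E (t ^+ 2) := mem_adjoin (t ^+ 2).
have /fin_all_exists[p pP] j : exists p, exists q, [/\ E p, E q & z j = p + q * t].
  by have [k lz] := Rz j; apply: low_even_odd lz.
have {pP} /fin_all_exists[q pqP] := pP.
(* Splitting the z_j into even and odd parts gives al + be t = 1; since a_j t is in R, also al t and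
   be t lie in R[t^2]. *)
pose al := \sum_j a j * p j; pose be := \sum_j a j * q j.
have Esum F : (forall j, E (F j)) -> E (\sum_(j < m) F j) by move=> EF; apply: subring_sum.
have Ep j : E (p j) by case: (pqP j).
have Eq j : E (q j) by case: (pqP j).
have Eal : E al by apply: Esum => j; apply: (subringM sE) => //; apply: RE.
have Ebe : E be by apply: Esum => j; apply: (subringM sE) => //; apply: RE.
have Ealt : E (al * t).
  rewrite mulr_suml; apply: Esum => j; rewrite mulrAC.
  by apply: (subringM sE) => //; apply: RE.
have Ebet : E (be * t).
  rewrite mulr_suml; apply: Esum => j; rewrite mulrAC.
  by apply: (subringM sE) => //; apply: RE.
have ab1 : be * t = 1 - al.
  rewrite -az1 /al -sumrB mulr_suml; apply: eq_bigr => j _.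
  by have [_ _ ->] := pqP j; ring.
have [k lt] : E t.
  (* This is (be t)^2 t = (1 - al)^2 t solved for t. *)
  have -> : t = al * t + al * t - al * (al * t) + be * (be * t) * t ^+ 2.
    have -> : be * (be * t) * t ^+ 2 = (be * t) * (be * t) * t by ring.
    by rewrite ab1; ring.
  apply: (subringD sE); last first.
    by apply: (subringM sE) => //; apply: (subringM sE).
  apply: (subringB sE); first exact: (subringD sE).
  exact: (subringM sE).
(* The bound [k.+1] ensures that the coefficient list reaches index 1. *)
have [|d [Rd d1 td]] := @low_sqr_coef t k.+1 t.
  by apply: low_widen lt => //; apply: leqnSn.
have := @coef_denom_sum _ _ sR T t k.*2.+1 (fun i => (i == 1)%:R - d i) sT RT
  prufer_int_closed Tt.
move=> /(_ _ _ 1%N); rewrite eqxx d1 subr0; apply=> // [i|].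
  by apply: RB => //; case: eqP => // _; apply: subring1.
under eq_bigr do rewrite mulrBl.
rewrite sumrB -doubleS -td doubleS !big_ord_recl big1 /=.
  by rewrite expr1; ring.
by move=> i _; rewrite mul0r.
Qed.

(* The R-module I spanned by 1 and ts is invertible: any R-module N containing
   (R : I) I contains 1. *)
Lemma prufer_invertible (ts : seq S) (N : S -> Prop) :
  (forall t, t \in ts -> T t) ->
  (forall x y, N x -> N y -> N (x + y)) -> (forall r x, R r -> N x -> N (r * x)) ->
  (forall r u, R r -> (forall t, t \in ts -> R (r * t)) -> u \in 1 :: ts -> N (r * u)) ->
  N 1.
Proof.
move=> + ND NZ; elim: ts => [|t0 ts IHts] Tts Ngen.
  rewrite -[1]mulr1; apply: Ngen => //; [exact: subring1 | exact: mem_head].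
apply: IHts => [t tst|r u Rr Rrt uts].
  by apply: Tts; rewrite inE tst orbT.
have Trt0 : T (r * t0) by apply: subringM => //; [exact: RT | apply/Tts/mem_head].
(* For r in the colon of the smaller module, a r and b r also carry t0 into R; hence r u = (a r) u +
   (r u) (b r) t0 lies in N. *)
have [a [b [Ra Rb Rart Rbrt ab1]]] := prufer_denom_sum Trt0.
have Rru : R (r * u).
  by move: uts; rewrite inE => /predU1P[->|/Rrt//]; rewrite mulr1.
have inv c : R c -> R (c * (r * t0)) -> forall t, t \in t0 :: ts -> R (c * r * t).
  move=> Rc Rcrt t; rewrite inE -mulrA => /predU1P[->//|tst].
  by apply: RM => //; apply: Rrt.
have -> : r * u = a * r * u + r * u * (b * r * t0).
  by rewrite -{1}[r * u]mulr1 ab1; ring.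
apply: ND; last apply: NZ => //.
  apply: Ngen; [exact: RM | exact: inv |].
  by move: uts; rewrite !inE => /orP[]->; rewrite ?orbT.
by apply: Ngen; [exact: RM | exact: inv | rewrite !inE eqxx orbT].
Qed.

End PruferElements.

(** * Almost-Prüfer extensions *)

Section AlmostPrufer.
Variables (S : comPzRingType) (R T : S -> Prop).
Hypotheses (sR : subring R) (sT : subring T) (RT : incl R T).
Hypotheses (prufRT : prufer R T) (intT : forall x, integral T x).

Let top : S -> Prop := fun _ => True.

Lemma almost_prufer_quasi : quasi_prufer R top.
Proof.
have sI := subring_integral sR.
have sA : subring (int_closure R top).
  by case: sI => I1 IB IM; split=> // x y [_ ix] [_ iy]; split=> //; [apply: IB | apply: IM].
have RA r : R r -> int_closure R top r by move=> Rr; split=> //; apply: integral_incl.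
apply: denom_sum_prufer => // s _; have [n [c [Tc sn]]] := intT s.
apply: (@prufer_invertible S R T sR sT RT prufRT (codom c)).
- by move=> t /codomP[i ->].
- by move=> x y; apply: denom_sumD.
- by move=> r x Rr; apply: denom_sum_scale => //; apply: RA.
- move=> r u Rr Rrt.
  (* Scaling by r brings the integral equation of s into R; the default value r is the leading
     coefficient, at index n. *)
  pose d i := if insub i is Some j then r * c j else r.
  have Kd : forall i, (i <= n)%N -> denom_sum (int_closure R top) s (d i).
    apply: (@coef_denom_sum _ _ sA top) => //.
    + move=> x _ ix; split=> //; apply: integral_trans => //.
      by have [m [e [Ae ex]]] := ix; exists m, e; split=> // i; case: (Ae i).
    + by move=> i; apply: RA; rewrite /d; case: insubP => // j _ _; apply/Rrt/codom_f.
    + rewrite big_ord_recr /=.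
      have -> : d n = r by rewrite /d insubF // ltnn.
      rewrite -[RHS](mulr0 r) -[in RHS]sn mulrDr addrC mulr_sumr; congr (_ + _).
      by apply: eq_bigr => i _; rewrite /d valK mulrA.
  rewrite inE => /predU1P[->|/codomP[i ->]].
    by have := Kd n (leqnn n); rewrite /d insubF ?ltnn // mulr1.
  by have := Kd i (ltnW (ltn_ord i)); rewrite /d valK.
Qed.

Lemma flat_epi_sub_hull V : interm R top V -> flat_epi R V -> incl V T.
Proof.
move=> [sV RV _] [fl ep] v Vv.
have [m [a [z [Ra Rav Vz az1]]]] := flat_epi_locally_denom sR sV RV fl ep Vv.
suff [_] : T 1 /\ T (1 * v) by rewrite mul1r.
apply: (@integral_ideal1 S T sT (fun a => T a /\ T (a * v)) m a z) => //.
- by rewrite mul0r; split; apply: subring0.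
- by move=> u [].
- by move=> u w [Tu Tuv] [Tw Twv]; rewrite mulrBl; split; apply: subringB.
- by move=> r u Tr [Tu Tuv]; rewrite -mulrA; split; apply: subringM.
- by move=> j; split; apply: RT.
Qed.

Lemma prufer_flat_epi V : interm R top V -> prufer R V -> flat_epi R V.
Proof. by move=> [sV RV _]; apply; split. Qed.

(** V lies in T, and the Prüfer property passes to subextensions. *)
Lemma flat_epi_prufer V : interm R top V -> flat_epi R V -> prufer R V.
Proof.
move=> iV fV U [sU RU UV]; apply: prufRT; split=> // u /UV.
exact: flat_epi_sub_hull.
Qed.

Lemma almost_prufer_hull : prufer_hull R top T.
Proof.
split=> [|V [iV pV]]; first by split=> //; split.
by apply: flat_epi_sub_hull => //; apply: prufer_flat_epi.
Qed.

Lemma almost_prufer_morita : morita_hull R top T.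
Proof.
have iT : interm R top T by split.
split=> [|V [iV fV]]; first by split=> //; apply: prufer_flat_epi.
exact: flat_epi_sub_hull.
Qed.

End AlmostPrufer.

(** * Passage to localizations *)

Section Localization.
Variables (S L : comPzRingType) (R M : S -> Prop) (phi : {rmorphism S -> L}).
Hypotheses (sR : subring R) (M1 : M 1) (MM : forall x y, M x -> M y -> M (x * y)).
Hypothesis MR : incl M R.
Hypothesis locM : is_localization M phi.

Lemma loc_subI (T : S -> Prop) t : T t -> loc_sub M phi T (phi t).
Proof. by move=> Tt; exists t, 1, 1; rewrite rmorph1 !mulr1. Qed.

Lemma subring_loc (T : S -> Prop) : subring T -> incl R T -> subring (loc_sub M phi T).
Proof.
move=> sT RT; split; first by rewrite -(rmorph1 phi); apply: loc_subI; apply: subring1.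
  move=> _ _ [t [m [v [Tt Mm vm ->]]]] [t' [m' [v' [Tt' Mm' vm' ->]]]].
  exists (t * m' - t' * m), (m * m'), (v * v'); split.
  - by apply: subringB => //; apply: subringM => //; apply/RT/MR.
  - exact: MM.
  - by rewrite rmorphM mulrACA vm vm' mulr1.
  - rewrite rmorphB !rmorphM.
    have -> : (phi t * phi m' - phi t' * phi m) * (v * v') =
      phi t * v * (v' * phi m') - phi t' * v' * (v * phi m) by ring.
    by rewrite vm vm' !mulr1.
move=> _ _ [t [m [v [Tt Mm vm ->]]]] [t' [m' [v' [Tt' Mm' vm' ->]]]].
exists (t * t'), (m * m'), (v * v'); split.
- exact: subringM.
- exact: MM.
- by rewrite rmorphM mulrACA vm vm' mulr1.
- by rewrite rmorphM mulrACA.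
Qed.

(** For the fraction t/m, the relation 1 = a + b t becomes 1 = a + (b m)(t/m). *)
Lemma prufer_loc (T : S -> Prop) : subring T -> incl R T ->
  prufer R T -> prufer (loc_sub M phi R) (loc_sub M phi T).
Proof.
move=> sT RT pRT; have sRM := subring_loc sR (fun _ => id).
apply: denom_sum_prufer => // _ [t [m [v [Tt Mm vm ->]]]].
have [a [b [Ra Rb Rat Rbt ab1]]] := prufer_denom_sum sR sT RT pRT Tt.
exists (phi a), (phi (b * m)); split.
- exact: loc_subI.
- by apply: loc_subI; apply: subringM => //; apply: MR.
- by exists (a * t), m, v; rewrite rmorphM mulrA.
- have -> : phi (b * m) * (phi t * v) = phi (b * t) * (v * phi m) by rewrite !rmorphM; ring.
  by rewrite vm mulr1; apply: loc_subI.
- have -> : phi (b * m) * (phi t * v) = phi (b * t) * (v * phi m) by rewrite !rmorphM; ring.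
  by rewrite vm mulr1 -rmorphD -ab1 rmorph1.
Qed.

Lemma integral_loc (T : S -> Prop) : subring T -> incl R T ->
  (forall x, integral T x) -> forall l, integral (loc_sub M phi T) l.
Proof.
move=> sT RT intT l; have [_ locE _] := locM.
have [s [m [v [Mm vm ->]]]] := locE l; have [n [c [Tc sn]]] := intT s.
have sTM := subring_loc sT RT.
(* The equation of s divided by m^n, where v is the inverse of m. *)
exists n, (fun i => phi (c i) * v ^+ (n - i)); split=> [i|].
  apply: subringM => //; first exact: loc_subI.
  by apply: subringX => //; exists 1, m, v; rewrite rmorph1 mul1r; split=> //; apply: subring1.
transitivity (phi (s ^+ n + \sum_i c i * s ^+ i) * v ^+ n); last by rewrite sn rmorph0 mul0r.
rewrite rmorphD rmorph_sum mulrDl mulr_suml rmorphXn exprMn; congr (_ + _).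
apply: eq_bigr => i _; rewrite rmorphM rmorphXn exprMn.
have -> : v ^+ n = v ^+ (n - i) * v ^+ i by rewrite -exprD subnK // ltnW.
ring.
Qed.

End Localization.

(** Greatest elements are unique, so a common witness U expresses the equality of the two hulls, and
    its localization being a hull expresses the local equality. *)
Theorem theorem4p4 (S : comPzRingType) (R : S -> Prop) :
  subring R -> almost_prufer R (fun _ => True) ->
  [/\ quasi_prufer R (fun _ => True),
      (exists U : S -> Prop,
         [/\ prufer_hull R (fun _ => True) U,
             morita_hull R (fun _ => True) U &
             forall P : S -> Prop, prime_ideal R P ->
             forall (L : comPzRingType) (phi : {rmorphism S -> L}),
               is_localization (fun m => R m /\ ~ P m) phi ->
               prufer_hull (loc_sub (fun m => R m /\ ~ P m) phi R)
                           (fun _ => True)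
                           (loc_sub (fun m => R m /\ ~ P m) phi U)]) &
      forall T : S -> Prop, interm R (fun _ => True) T ->
        flat_epi R T -> prufer R T].
Proof.
move=> sR [T [[sT RT _] pRT intT]].
have {}intT x : integral T x by apply: intT.
split; first exact: (almost_prufer_quasi sR sT RT pRT intT).
  exists T; split.
  - exact: (almost_prufer_hull sR sT RT pRT intT).
  - exact: (almost_prufer_morita sR sT RT pRT intT).
  move=> P [_ _ _ _ [P1 Pprime]] L phi locM; set M := fun m => R m /\ ~ P m.
  have M1 : M 1 by split=> //; apply: subring1.
  have MM x y : M x -> M y -> M (x * y).
    move=> [Rx Px] [Ry Py]; split; first exact: subringM.
    by move=> /(Pprime x y Rx Ry)[].
  have MR : incl M R by move=> m [].
  (* The localized extension is again almost-Prüfer, with the localization of T as intermediate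
     ring. *)
  apply: almost_prufer_hull.
  - exact: (subring_loc phi M1 MM MR sR (fun _ => id)).
  - exact: (subring_loc phi M1 MM MR sT RT).
  - by move=> l [t [m [v [Rt Mm vm ->]]]]; exists t, m, v; split=> //; apply: RT.
  - exact: prufer_loc.
  - exact: (integral_loc M1 MM MR locM sT RT intT).
exact: (flat_epi_prufer sR sT RT pRT intT).
Qed.
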